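(* Let $H(x)>0$ ($x\ge 0$) be an $m\times m$ matrix function (a Hamiltonian), and let $A$, $S(0)$ be $n\times n$ matrices and $\Pi(0)$ an $n\times m$ matrix such that $S(0)>0$ and $$AS(0)-S(0)A^*=\mathrm{i}\,\Pi(0)\,j\,\Pi(0)^*.$$ Let the matrix functions $\Pi(x)$ ($n\times m$), $S(x)$ ($n\times n$) and $u(x)$ ($m\times m$), $x\ge0$, be determined by the given initial values $\Pi(0)$, $S(0)$ and by $$\Pi'(x)=-\mathrm{i}A\Pi(x)jH(x),\qquad S'(x)=\Pi(x)jH(x)j\Pi(x)^*,$$ $$u'(x)=-\widetilde q_0(x)u(x),\qquad u(0)=I_m,$$ where $$\widetilde q_0(x):=j\Pi(x)^*S(x)^{-1}\Pi(x)jH(x)-jH(x)j\Pi(x)^*S(x)^{-1}\Pi(x).$$ Then the matrix functions $$Y(x,t):=u(x)^*H(x)j\Pi(x)^*S(x)^{-1}\mathrm{e}^{\mathrm{i}tA},\qquad \mathcal H(x):=u(x)^{-1}H(x)^{-1}\big(u(x)^*\big)^{-1}$$ satisfy the dynamical canonical system $$\frac{\partial}{\partial t}Y(x,t)=j\frac{\partial}{\partial x}\Big(\mathcal H(x)Y(x,t)\Big),\qquad \mathcal H(x)>0.$$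
   Context: All matrices are complex; $n\in\mathbb N$; $m_1\ge0$, $m_2\ge0$, $m=m_1+m_2>0$; $I_p$ is the $p\times p$ identity matrix; $j=\begin{bmatrix} I_{m_1}&0\\0&-I_{m_2}\end{bmatrix}$. $M^*$ is the conjugate transpose of $M$, and $M>0$ (resp. $M\ge 0$) means $M$ is Hermitian positive definite (resp. positive semidefinite). A prime denotes $d/dx$. $\Pi$, $S$, $u$ are understood as (differentiable) solutions on $x\ge0$ of the stated differential equations. Since $S(0)>0$ and $S'(x)\ge0$, the matrices $S(x)$ are positive definite, hence invertible. *)

(* Defs.v *)
From HB Require Import structures.
From mathcomp Require Import all_boot all_order all_algebra.
From mathcomp Require Import all_classical all_reals all_analysis.
From mathcomp Require Import complex spectral.

Set Implicit Arguments.
Unset Strict Implicit.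
Unset Printing Implicit Defensive.

Import Order.TTheory GRing.Theory Num.Theory.
Import numFieldNormedType.Exports.

Local Open Scope classical_set_scope.
Local Open Scope ring_scope.
Local Open Scope sesquilinear_scope.

Section Defs.
Variable R : realType.
Local Notation C := R[i].

(* In the order of R[i], 0 < z says that z is real and positive. *)
Definition posdefmx (p : nat) (M : 'M[C]_p) : Prop :=
  M ^t* = M /\
  forall v : 'cV[C]_p, v != 0 -> 0 < (v ^t* *m M *m v) ord0 ord0.

(* Entrywise derivative, along D, of a matrix function of a real variable.
   For D = `[0, +oo[ it is one-sided at 0 and ignores the values of f at
   negative arguments. The regular module C^o carries the topology of C. *)
Definition is_mxderive (D : set R) (p q : nat) (f : R -> 'M[C]_(p, q))
    (x : R) (df : 'M[C]_(p, q)) : Prop :=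
  forall (k : 'I_p) (l : 'I_q),
    (fun y : R => ((y - x)^-1)%:C%C * (f y k l - f x k l) : C^o)
      @ within D x^' --> (df k l : C^o).

Definition expmx (p : nat) (M : 'M[C]_p) : 'M[C]_p :=
  \matrix_(k, l)
    limn (fun N : nat => (\sum_(r < N) (r`!%:R : C)^-1 *: M ^+ r) k l : C^o).

Definition jmx (m1 m2 : nat) : 'M[C]_(m1 + m2) :=
  block_mx 1%:M 0 0 (- 1%:M).

Section System.
Variables (n m1 m2 : nat).
Local Notation m := (m1 + m2)%N.
Local Notation j := (jmx m1 m2).
Variables (A : 'M[C]_n) (H : R -> 'M[C]_m).
Variables (Pi : R -> 'M[C]_(n, m)) (S : R -> 'M[C]_n) (u : R -> 'M[C]_m).

Definition q0tilde (x : R) : 'M[C]_m :=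
  j *m (Pi x) ^t* *m invmx (S x) *m Pi x *m j *m H x
  - j *m H x *m j *m (Pi x) ^t* *m invmx (S x) *m Pi x.

Definition Ymx (x t : R) : 'M[C]_(m, n) :=
  (u x) ^t* *m H x *m j *m (Pi x) ^t* *m invmx (S x)
  *m expmx (('i * t%:C%C) *: A).

Definition calH (x : R) : 'M[C]_m :=
  invmx (u x) *m invmx (H x) *m invmx ((u x) ^t*).

End System.
End Defs.

Arguments jmx {R} m1 m2.

(* Main.v *)
(* Two quantities are conserved: [A S - S A^* - i Pi j Pi^* = 0], and
   [u^* j u = j], the latter because [j q0tilde] is skew-Hermitian. Since
   [v^* S v] has derivative [w^* H w >= 0] with [w = j Pi^* v], [S x] stays
   positive definite. The second conservation law gives [u^-1 = j u^* j], so
   [calH Y = j u^* Pi^* S^-1 exp(itA)]. In the derivative of this product the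
   terms quadratic in [Pi^* S^-1 Pi] cancel, and the first law, multiplied by
   [S^-1] on both sides, turns the rest into
   [j u^* H j Pi^* S^-1 (iA) exp(itA)], which is [j] times the [t]-derivative
   of [Y]. *)
Require Import Defs.
From HB Require Import structures.
From mathcomp Require Import all_boot all_order all_algebra.
From mathcomp Require Import all_classical all_reals all_analysis.
From mathcomp Require Import complex spectral ring.

Set Implicit Arguments.
Unset Strict Implicit.
Unset Printing Implicit Defensive.

Import Order.TTheory GRing.Theory Num.Theory.
Import numFieldNormedType.Exports.

Local Open Scope classical_set_scope.
Local Open Scope ring_scope.
Local Open Scope sesquilinear_scope.

(** * Limits in [C] and of matrices *)

Section ComplexLimits.
Variable R : realType.
Local Notation C := R[i].

Lemma complexReB (z w : C) : complex.Re (z - w) = complex.Re z - complex.Re w.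
Proof. by case: z w => [? ?] []. Qed.

Lemma complexImB (z w : C) : complex.Im (z - w) = complex.Im z - complex.Im w.
Proof. by case: z w => [? ?] []. Qed.

Lemma normc_ge_Im (z : C) : `|complex.Im z|%:C%C <= `|z|.
Proof.
rewrite -normrN -ReiNIm (le_trans (normc_ge_Re _))// normrM.
by rewrite -[`|'i%C|]/(`|'i|) normCi mulr1.
Qed.

Lemma cvg_complexP (T : Type) (F : set_system T) {FF : Filter F}
    (f : T -> C) (a : C) :
  (f x : C^o) @[x --> F] --> (a : C^o) <->
  (complex.Re (f x) @[x --> F] --> complex.Re a /\
   complex.Im (f x) @[x --> F] --> complex.Im a).
Proof.
split=> [fa|[/cvgrPdist_lt fr /cvgrPdist_lt fi]].
  split; apply/cvgrPdist_lt => e e0.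
    move/cvgrPdist_lt/(_ e%:C%C) : fa; rewrite ltcR => /(_ e0).
    apply: filterS => x xe; rewrite -ltcR -complexReB.
    exact: le_lt_trans (normc_ge_Re _) xe.
  move/cvgrPdist_lt/(_ e%:C%C) : fa; rewrite ltcR => /(_ e0).
  apply: filterS => x xe; rewrite -ltcR -complexImB.
  exact: le_lt_trans (normc_ge_Im _) xe.
apply/cvgrPdist_lt => e e0.
(* The radius [e] is itself complex; being positive in the order of [R[i]] it is real, and each
   component may use half of it. *)
have er : e = (complex.Re e)%:C%C by rewrite RRe_real // gtr0_real.
have e20 : 0 < complex.Re e / 2 by rewrite divr_gt0// -ltcR -er.
apply: filterS2 (fr _ e20) (fi _ e20) => x; rewrite -complexReB -complexImB.
set z := (X in complex.Re X) => zr zi; rewrite -/z.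
rewrite (complexE z) (le_lt_trans (ler_normD _ _))// er.
rewrite normrM -[`|'i%C|]/(`|'i|) normCi mul1r (splitr (complex.Re e)).
rewrite rmorphD/= ltrD//.
  by rewrite normc_def/= expr0n addr0 sqrtr_sqr ltcR.
by rewrite normc_def/= expr0n addr0 sqrtr_sqr ltcR.
Qed.

Lemma cvg_conjC (T : Type) (F : set_system T) {FF : Filter F}
    (f : T -> C) (a : C) :
  (f x : C^o) @[x --> F] --> (a : C^o) ->
  (Num.conj (f x) : C^o) @[x --> F] --> (Num.conj a : C^o).
Proof.
move=> /cvg_complexP[fr fi]; apply/cvg_complexP; split.
  have -> : (fun x => complex.Re (Num.conj (f x))) =
      (fun x => complex.Re (f x)).
    by apply/funext => x /=; case: (f x).
  by case: a fr fi.
have -> : (fun x => complex.Im (Num.conj (f x))) =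
    (fun x => - complex.Im (f x)).
  by apply/funext => x /=; case: (f x).
by case: a fr fi => a b _ fi; exact: cvgN.
Qed.

Lemma near_eq_cvg_complex (T : Type) (F : set_system T) {FF : Filter F}
    (f g : T -> C) (a : C) :
  (\forall x \near F, f x = g x) -> (f x : C^o) @[x --> F] --> (a : C^o) ->
  (g x : C^o) @[x --> F] --> (a : C^o).
Proof.
by move=> fg; apply: cvg_trans; apply: near_eq_cvg; apply: filterS fg => x ->.
Qed.

Lemma cvg_complexD (T : Type) (F : set_system T) {FF : Filter F}
    (f g : T -> C) (a b : C) :
  (f x : C^o) @[x --> F] --> (a : C^o) ->
  (g x : C^o) @[x --> F] --> (b : C^o) ->
  (f x + g x : C^o) @[x --> F] --> (a + b : C^o).
Proof. by move=> fa gb; exact: (@cvgD _ C^o _ _ _ _ _ _ _ fa gb). Qed.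

Lemma cvg_complexM (T : Type) (F : set_system T) {FF : Filter F}
    (f g : T -> C) (a b : C) :
  (f x : C^o) @[x --> F] --> (a : C^o) ->
  (g x : C^o) @[x --> F] --> (b : C^o) ->
  (f x * g x : C^o) @[x --> F] --> (a * b : C^o).
Proof. exact: cvgM. Qed.

Lemma cvg_complex_sum (T I : Type) (F : set_system T) {FF : Filter F}
    (r : seq I) (f : I -> T -> C) (a : I -> C) :
  (forall i, (f i x : C^o) @[x --> F] --> (a i : C^o)) ->
  (\sum_(i <- r) f i x : C^o) @[x --> F] --> (\sum_(i <- r) a i : C^o).
Proof.
move=> fa; elim: r => [|i r IH].
  by rewrite big_nil; under eq_fun do rewrite big_nil; exact: cvg_cst.
rewrite big_cons; under eq_fun do rewrite big_cons.
exact: (cvg_complexD (fa i) IH).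
Qed.

Lemma cvg_complex_prod (T I : Type) (F : set_system T) {FF : Filter F}
    (r : seq I) (f : I -> T -> C) (a : I -> C) :
  (forall i, (f i x : C^o) @[x --> F] --> (a i : C^o)) ->
  (\prod_(i <- r) f i x : C^o) @[x --> F] --> (\prod_(i <- r) a i : C^o).
Proof.
move=> fa; elim: r => [|i r IH].
  by rewrite big_nil; under eq_fun do rewrite big_nil; exact: cvg_cst.
rewrite big_cons; under eq_fun do rewrite big_cons.
exact: (cvg_complexM (fa i) IH).
Qed.

(** Convergence is taken entrywise, to fit the entrywise limits of [is_mxderive]. *)
Definition mxcvg (T : Type) (F : set_system T) (p q : nat)
    (M : T -> 'M[C]_(p, q)) (N : 'M[C]_(p, q)) : Prop :=
  forall k l, (M x k l : C^o) @[x --> F] --> (N k l : C^o).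

Lemma cvg_det (T : Type) (F : set_system T) {FF : Filter F} (p : nat)
    (M : T -> 'M[C]_p) (N : 'M[C]_p) :
  mxcvg F M N ->
  (\det (M x) : C^o) @[x --> F] --> (\det N : C^o).
Proof.
move=> MN; apply: cvg_complex_sum => s; apply: cvg_complexM.
  exact: cvg_cst.
by apply: cvg_complex_prod => k; exact: MN.
Qed.

(** By Cramer's rule each entry of the inverse is a cofactor over the determinant, both polynomial
    in the entries. Invertibility is required along [F] because [invmx] returns a singular matrix
    unchanged. *)
Lemma cvg_invmx (T : Type) (F : set_system T) {FF : Filter F} (p : nat)
    (M : T -> 'M[C]_p) (N : 'M[C]_p) :
  (\forall x \near F, M x \in unitmx) -> N \in unitmx ->
  mxcvg F M N -> mxcvg F (fun x => invmx (M x)) (invmx N).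
Proof.
move=> Mu Nu MN k l.
have -> : invmx N k l = (\det N)^-1 * cofactor N l k.
  by rewrite /invmx Nu !mxE.
suff h : ((\det (M x))^-1 * cofactor (M x) l k : C^o) @[x --> F]
    --> ((\det N)^-1 * cofactor N l k : C^o).
  apply: near_eq_cvg_complex h; apply: filterS Mu => x Mx.
  by rewrite /invmx Mx !mxE.
apply: cvg_complexM.
  apply: (@cvgV C); last exact: cvg_det.
  by rewrite -unitfE -unitmxE.
apply: cvg_complexM; first exact: cvg_cst.
by apply: cvg_det => a b; rewrite !mxE; under eq_fun do rewrite !mxE; exact: MN.
Qed.

Lemma mxcvgM (T : Type) (F : set_system T) {FF : Filter F} (p q r : nat)
    (M : T -> 'M[C]_(p, q)) (M' : T -> 'M[C]_(q, r)) N N' :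
  mxcvg F M N -> mxcvg F M' N' -> mxcvg F (fun x => M x *m M' x) (N *m N').
Proof.
move=> MN MN' k l; rewrite mxE; under eq_fun do rewrite mxE.
by apply: cvg_complex_sum => i; exact: (cvg_complexM (MN k i) (MN' i l)).
Qed.

Lemma mxcvgD (T : Type) (F : set_system T) {FF : Filter F} (p q : nat)
    (M M' : T -> 'M[C]_(p, q)) N N' :
  mxcvg F M N -> mxcvg F M' N' -> mxcvg F (fun x => M x + M' x) (N + N').
Proof.
move=> MN MN' k l; rewrite mxE; under eq_fun do rewrite mxE.
exact: (cvg_complexD (MN k l) (MN' k l)).
Qed.

Lemma mxcvg_cst (T : Type) (F : set_system T) {FF : Filter F} (p q : nat)
    (N : 'M[C]_(p, q)) : mxcvg F (fun=> N) N.
Proof. by move=> k l; exact: cvg_cst. Qed.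

Lemma mxcvg_adj (T : Type) (F : set_system T) {FF : Filter F} (p q : nat)
    (M : T -> 'M[C]_(p, q)) N :
  mxcvg F M N -> mxcvg F (fun x => (M x) ^t*) (N ^t*).
Proof.
move=> MN k l; rewrite !mxE; under eq_fun do rewrite !mxE.
exact: (cvg_conjC (MN l k)).
Qed.

Lemma near_eq_mxcvg (T : Type) (F : set_system T) {FF : Filter F} (p q : nat)
    (M M' : T -> 'M[C]_(p, q)) N :
  (\forall x \near F, M x = M' x) -> mxcvg F M N -> mxcvg F M' N.
Proof.
move=> MM' MN k l; apply: near_eq_cvg_complex (MN k l).
by apply: filterS MM' => x ->.
Qed.

End ComplexLimits.

(** * Calculus of [is_mxderive] *)

Section MatrixDerivative.
Variable R : realType.
Local Notation C := R[i].
Variables (D : set R) (x : R).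

Local Notation F := (within D x^').

Lemma is_mxderiveP (p q : nat) (f : R -> 'M[C]_(p, q)) df :
  is_mxderive D f x df <->
  mxcvg F (fun y => ((y - x)^-1)%:C%C *: (f y - f x)) df.
Proof.
split=> fd k l; first by under eq_fun do rewrite !mxE; exact: fd.
by have := fd k l; under eq_fun do rewrite !mxE.
Qed.

Let near_neq : \forall y \near F, y - x != 0.
Proof.
have h : \forall y \near x^', y != x by exact: nbhs_dnbhs_neq.
by apply: (cvg_within D); apply: filterS h => y; rewrite subr_eq0.
Qed.

Let near_in (P : R -> Prop) : (forall y, D y -> P y) -> \forall y \near F, P y.
Proof.
by move=> DP; have := withinT D (dnbhs_filter x); apply: filterS.
Qed.

(** The increment of [f] is the difference quotient times [y - x], which tends to 0; the filter
    excludes [y = x], so the factor cancels. *)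
Lemma is_mxderive_cvg (p q : nat) (f : R -> 'M[C]_(p, q)) df :
  is_mxderive D f x df -> mxcvg F f (f x).
Proof.
move=> fd k l.
have h0 : ((y - x)%:C%C : C^o) @[y --> F] --> (0 : C^o).
  apply/cvg_complexP; split => /=; last exact: cvg_cst.
  rewrite -[X in _ --> X](subrr x); apply: cvgB; last exact: cvg_cst.
  exact: cvg_trans (cvg_within D) (@nbhs_dnbhs _ x).
have h : ((y - x)%:C%C * (((y - x)^-1)%:C%C * (f y k l - f x k l)) + f x k l
    : C^o) @[y --> F] --> (0 * df k l + f x k l : C^o).
  by apply: cvg_complexD; [exact: (cvg_complexM h0 (fd k l))|exact: cvg_cst].
move: h; rewrite mul0r add0r => h; apply: near_eq_cvg_complex h.
apply: filterS near_neq => y yx /=.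
by rewrite mulrA -rmorphM/= mulfV// mul1r subrK.
Qed.

Lemma is_mxderiveM (p q r : nat) (f : R -> 'M[C]_(p, q))
    (g : R -> 'M[C]_(q, r)) df dg :
  is_mxderive D f x df -> is_mxderive D g x dg ->
  is_mxderive D (fun y => f y *m g y) x (df *m g x + f x *m dg).
Proof.
move=> fd gd; apply/is_mxderiveP.
(* Adding and subtracting [f x *m g y] leaves [g y] in the first term; its limit comes from the
   continuity of [g] at [x]. *)
have -> : (fun y => ((y - x)^-1)%:C%C *: (f y *m g y - f x *m g x)) =
  (fun y => (((y - x)^-1)%:C%C *: (f y - f x)) *m g y
            + f x *m (((y - x)^-1)%:C%C *: (g y - g x))).
  apply/funext => y; rewrite -scalemxAr -scalemxAl -scalerDr; congr (_ *: _).
  by rewrite mulmxBl mulmxBr addrA subrK.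
apply: mxcvgD; apply: mxcvgM.
- exact/is_mxderiveP.
- exact: is_mxderive_cvg gd.
- exact: mxcvg_cst.
- exact/is_mxderiveP.
Qed.

Lemma is_mxderiveD (p q : nat) (f g : R -> 'M[C]_(p, q)) df dg :
  is_mxderive D f x df -> is_mxderive D g x dg ->
  is_mxderive D (fun y => f y + g y) x (df + dg).
Proof.
move=> /is_mxderiveP fd /is_mxderiveP gd; apply/is_mxderiveP.
apply: near_eq_mxcvg; last exact: (mxcvgD fd gd).
apply: filterE => y.
by rewrite -scalerDr opprD addrACA.
Qed.

Lemma is_mxderive_cst (p q : nat) (M : 'M[C]_(p, q)) :
  is_mxderive D (fun=> M) x 0.
Proof.
have h : mxcvg F (fun=> 0) (0 : 'M[C]_(p, q)) by exact: mxcvg_cst.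
apply/is_mxderiveP; apply: near_eq_mxcvg h.
by apply: filterE => y; rewrite subrr scaler0.
Qed.

Lemma is_mxderiveMl (p q r : nat) (M : 'M[C]_(p, q))
    (g : R -> 'M[C]_(q, r)) dg :
  is_mxderive D g x dg -> is_mxderive D (fun y => M *m g y) x (M *m dg).
Proof.
move=> gd; have := is_mxderiveM (is_mxderive_cst M) gd.
by rewrite mul0mx add0r.
Qed.

Lemma is_mxderiveMr (p q r : nat) (f : R -> 'M[C]_(p, q)) df
    (M : 'M[C]_(q, r)) :
  is_mxderive D f x df -> is_mxderive D (fun y => f y *m M) x (df *m M).
Proof.
move=> fd; have := is_mxderiveM fd (is_mxderive_cst M).
by rewrite mulmx0 addr0.
Qed.

(** Conjugation is continuous and fixes the real factor [(y - x)^-1]. *)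
Lemma is_mxderive_adj (p q : nat) (f : R -> 'M[C]_(p, q)) df :
  is_mxderive D f x df -> is_mxderive D (fun y => (f y) ^t*) x (df ^t*).
Proof.
move=> /is_mxderiveP fd; apply/is_mxderiveP.
apply: near_eq_mxcvg; last exact: (mxcvg_adj fd).
apply: filterE => y.
apply/matrixP => k l; rewrite !mxE rmorphM rmorphB/=; congr (_ * _).
by rewrite /Num.conj/= /conjc oppr0.
Qed.

(** The limit is taken within [D]; [D x] is there because the value at [x] enters every difference
    quotient. *)
Lemma eq_is_mxderive (p q : nat) (f g : R -> 'M[C]_(p, q)) df :
  D x -> (forall y, D y -> f y = g y) ->
  is_mxderive D f x df -> is_mxderive D g x df.
Proof.
move=> Dx fg /is_mxderiveP fd; apply/is_mxderiveP.
apply: near_eq_mxcvg fd; apply: near_in => y Dy; rewrite !fg//.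
Qed.

(** Lets the rules of calculus produce a derivative in whatever shape, leaving its equality with the
    wanted one as an algebraic goal. *)
Lemma is_mxderive_eq (p q : nat) (f : R -> 'M[C]_(p, q)) df dg :
  is_mxderive D f x df -> df = dg -> is_mxderive D f x dg.
Proof. by move=> fd <-. Qed.

(** Follows from M^-1 - N^-1 = - M^-1 (M - N) N^-1 and the continuity of inversion. *)
Lemma is_mxderive_invmx (p : nat) (f : R -> 'M[C]_p) df :
  D x -> (forall y, D y -> f y \in unitmx) -> is_mxderive D f x df ->
  is_mxderive D (fun y => invmx (f y)) x
    (- (invmx (f x) *m df *m invmx (f x))).
Proof.
move=> Dx fu fd; apply/is_mxderiveP.
have fuD : \forall y \near F, f y \in unitmx.
  exact: near_in.
(* The sign is written as a factor [(-1)%:M], so that [mxcvgM] covers the whole expression. *)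
have h : mxcvg F (fun y => (-1)%:M *m (invmx (f y) *m
    (((y - x)^-1)%:C%C *: (f y - f x)) *m invmx (f x)))
    ((-1)%:M *m (invmx (f x) *m df *m invmx (f x))).
  apply: mxcvgM; first exact: mxcvg_cst.
  apply: mxcvgM; last exact: mxcvg_cst.
  apply: mxcvgM; last exact/is_mxderiveP.
  have fc := is_mxderive_cvg fd; exact: (cvg_invmx fuD (fu x Dx) fc).
rewrite mul_scalar_mx scaleN1r in h; apply: near_eq_mxcvg h.
apply: filterS fuD => y fy.
rewrite mul_scalar_mx scaleN1r -scalemxAr -scalemxAl.
rewrite -scalerN; congr (_ *: _).
by rewrite mulmxBr mulmxBl mulVmx// mul1mx mulmxK ?fu// opprB.
Qed.

End MatrixDerivative.

(** * Monotonicity and constancy on the half-line *)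

Section Monotonicity.
Variable R : realType.
Local Notation C := R[i].
Local Notation D := (`[0 : R, +oo[%classic).

(** The mean value theorem on [0, b] for the real part of one entry. *)
Lemma is_mxderive_Re_le (p q : nat) (f df : R -> 'M[C]_(p, q)) k l :
  (forall x : R, 0 <= x -> is_mxderive D f x (df x)) ->
  (forall x : R, 0 <= x -> 0 <= complex.Re (df x k l)) ->
  forall x : R, 0 <= x -> complex.Re (f 0 k l) <= complex.Re (f x k l).
Proof.
move=> fd df0 b; rewrite le_eqVlt => /predU1P[<-//|b0].
pose g x := complex.Re (f x k l); pose dg x := complex.Re (df x k l).
(* Around an interior point [D] is a full neighbourhood, so the derivative within [D] is the
   ordinary one; [h = y - x] changes between the two forms of the quotient. *)
have gd x : x \in `]0, b[%R -> is_derive x 1 g (dg x).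
  rewrite in_itv/= => /andP[x0 _].
  have gx : (y - x)^-1 * (g y - g x) @[y --> within D x^'] --> dg x.
    have /cvg_complexP[+ _] := fd _ (ltW x0) k l.
    suff -> : (fun y => (y - x)^-1 * (g y - g x)) =
      (fun y => complex.Re (((y - x)^-1)%:C%C * (f y k l - f x k l))) by [].
    apply/funext => y; rewrite /g.
    by case: (f y k l) (f x k l) => [? ?] [? ?] /=; rewrite mul0r subr0.
  have shiftD : (fun h : R => h *: (1 : R) + x) @ 0^' --> within D x^'.
    move=> P; rewrite /within /= => DP.
    have kc : (fun h : R => h *: (1 : R) + x) @ (0 : R) --> x.
      rewrite -[X in _ --> X]add0r; apply: cvgD; last exact: cvg_cst.
      rewrite -[X in _ --> X](scale0r (1 : R)).
      by apply: cvgZr_tmp; exact: cvg_id.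
    have Dn : \forall y \near x, D y.
      by near=> y; rewrite /= in_itv/= andbT ltW//; near: y; exact: lt_nbhsr.
    have DP' : \forall y \near x, y != x -> P y.
      by apply: filterS2 Dn DP => y Dy dp yx; exact: dp.
    have kP : \forall h \near (0 : R),
        h *: (1 : R) + x != x -> P (h *: (1 : R) + x).
      exact: (kc _ DP').
    apply: filterS kP => h hP h0; apply: hP.
    by rewrite /GRing.scale/= mulr1 -subr_eq0 addrK.
  have gx' :
      h^-1 *: ((g \o shift x) (h *: (1 : R)) - g x) @[h --> 0^'] --> dg x.
    have := cvg_comp _ _ shiftD gx.
    suff -> : (fun h : R => h^-1 *: ((g \o shift x) (h *: (1 : R)) - g x)) =
      (fun y => (y - x)^-1 * (g y - g x)) \o
      (fun h : R => h *: (1 : R) + x) by [].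
    by apply/funext => h; rewrite /= addrK /GRing.scale/= mulr1.
  by split; [apply/cvg_ex; exists (dg x)|exact: cvg_lim].
(* Differentiability within [D] gives the limit along the punctured neighbourhood, also at the
   endpoint 0; the point itself is then added. *)
have gc : {within `[0, b], continuous g}.
  apply/subspace_continuousP => x; rewrite /= in_itv/= => /andP[x0 _].
  have fx : mxcvg (within D x^') f (f x) by exact: is_mxderive_cvg (fd _ x0).
  have /cvg_complexP[gx _] := fx k l.
  move=> P gP; suff : \forall y \near x, y \in `[0, b]%R -> P (g y) by [].
  have gP' : \forall y \near x, y != x -> D y -> P (g y) by exact: (gx _ gP).
  apply: filterS gP' => y yP; rewrite in_itv/= => /andP[y0 _].
  have [->|yx] := eqVneq y x; first exact: nbhs_singleton.
  by apply: yP => //; rewrite /= in_itv/= y0.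
have [c] := MVT b0 gd gc.
rewrite in_itv/= => /andP[c0 _] gE; rewrite -subr_ge0 -/(g b) -/(g 0) gE.
by apply: mulr_ge0; [exact: df0 (ltW c0)|rewrite subr0 ltW].
Unshelve. all: by end_near.
Qed.

(** Monotonicity applies to [c f] for c = 1, -1, i, -i, and the four inequalities pin down the real
    and imaginary parts. *)
Lemma is_mxderive0_cst (p q : nat) (f : R -> 'M[C]_(p, q)) :
  (forall x : R, 0 <= x -> is_mxderive D f x 0) ->
  forall x : R, 0 <= x -> f x = f 0.
Proof.
move=> fd x x0; apply/matrixP => k l.
have le c : complex.Re (c * f 0 k l) <= complex.Re (c * f x k l).
  have cd y : 0 <= y -> is_mxderive D (fun z => c%:M *m f z) y (c%:M *m 0).
    by move=> y0; exact: is_mxderiveMl (fd _ y0).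
  have := is_mxderive_Re_le (k := k) (l := l) cd _ x0.
  by rewrite !mul_scalar_mx !mxE; apply => y y0; rewrite mulr0.
have := (le 1, le (- 1), le 'i%C, le (- 'i%C)).
case: (f x k l) (f 0 k l) => [a b] [a' b'] /=.
rewrite !(mul0r, mul1r, mulN1r, oppr0, subr0, sub0r, addr0, mulNr, opprK).
rewrite !lerN2.
move=> [[[h1 h2] h3] h4]; congr (_ +i* _)%C; apply/le_anti.
  by rewrite h1 h2.
by rewrite h3 h4.
Qed.

End Monotonicity.

(** * The matrix exponential *)

(* Each entry of [expmx (x B)] splits into two real power series in [x], so
   that the real theorem [pseries_snd_diffs] on termwise differentiation
   applies. *)
Section MatrixExponential.
Variable R : realType.
Local Notation C := R[i].

(** Domination by the Taylor coefficients of M exp(K x): it forces convergence everywhere and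
    survives termwise differentiation. *)
Definition exp_bounded (a : nat -> R) : Prop :=
  exists M K : R,
    [/\ 0 <= M, 0 <= K & forall r, `|a r| <= M * (K ^+ r / r`!%:R)].

(** Since (r+1) K^(r+1) / (r+1)! = K K^r / r!, the constant [M] becomes [M * K] and [K] stays. *)
Lemma exp_bounded_diffs (a : nat -> R) :
  exp_bounded a -> exp_bounded (pseries_diffs a).
Proof.
move=> [M [K [M0 K0 aMK]]]; exists (M * K), K; split => //.
  by rewrite mulr_ge0.
move=> r; rewrite /pseries_diffs normrM normr_nat.
rewrite (le_trans (ler_wpM2l (ler0n R r.+1) (aMK r.+1)))// factS natrM exprS.
rewrite le_eqVlt; apply/orP; left; apply/eqP; field.
by rewrite nat1r !pnatr_eq0 -lt0n fact_gt0.
Qed.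

(** Absolute convergence by comparison with M times the exponential series at K |x|. *)
Lemma exp_bounded_cvg (a : nat -> R) x : exp_bounded a -> cvgn (pseries a x).
Proof.
move=> [M [K [M0 K0 aMK]]]; apply: normed_cvg.
have cM : cvgn (series (fun r => M * exp_coeff (K * `|x|) r)).
  exact: (is_cvg_seriesZ (k := M) (is_cvg_series_exp_coeff _)).
apply: series_le_cvg cM => r /=.
- exact: normr_ge0.
- by apply: mulr_ge0 => //; apply: exp_coeff_ge0; rewrite mulr_ge0.
- rewrite normrM normrX.
  rewrite (le_trans (ler_wpM2r (exprn_ge0 r (normr_ge0 x)) (aMK r)))//.
  by rewrite /exp_coeff /= exprMn -!mulrA [_^-1 * _]mulrC.
Qed.

Lemma is_derive_pseries (a : nat -> R) (x : R) : exp_bounded a ->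
  is_derive x (1 : R) (fun y => limn (pseries a y))
    (limn (pseries (pseries_diffs a) x)).
Proof.
(* Termwise differentiation asks that the series and its first two formal derivatives converge at a
   point of modulus larger than |x|. *)
move=> ab; apply: (@pseries_snd_diffs _ _ (`|x| + 1)).
- exact: exp_bounded_cvg.
- exact/exp_bounded_cvg/exp_bounded_diffs.
- exact/exp_bounded_cvg/exp_bounded_diffs/exp_bounded_diffs.
- by rewrite [ltRHS]ger0_norm ?addr_ge0// ltrDl.
Qed.

(** The substitution h = y - x brings an ordinary derivative into the form used by [is_mxderive]. *)
Lemma is_derive_cvg (g : R -> R) (x dg : R) :
  is_derive x (1 : R) g dg ->
  (y - x)^-1 * (g y - g x) @[y --> x^'] --> dg.
Proof.
move=> [gd gE].
have gx : h^-1 *: ((g \o shift x) (h *: (1 : R)) - g x) @[h --> 0^'] --> dg.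
  by rewrite -gE; exact: gd.
have shiftx : (fun y : R => y - x) @ x^' --> (0 : R)^'.
  move=> P P0.
  have P0' : \forall h \near (0 : R), h != 0 -> P h by [].
  have kc : (fun y : R => y - x) @ x --> (0 : R).
    rewrite -[X in _ --> X](subrr x); apply: cvgB; last exact: cvg_cst.
    exact: cvg_id.
  have kP : \forall y \near x, y - x != 0 -> P (y - x) by exact: (kc _ P0').
  suff : \forall y \near x, y != x -> P (y - x) by [].
  by apply: filterS kP => y hP; rewrite -subr_eq0.
have := cvg_comp _ _ shiftx gx.
suff -> : (fun h : R => h^-1 *: ((g \o shift x) (h *: (1 : R)) - g x)) \o
  (fun y => y - x) = (fun y => (y - x)^-1 * (g y - g x)) by [].
by apply/funext => y; rewrite /= /GRing.scale/= mulr1 subrK.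
Qed.

Lemma exprZmx (p : nat) (a : C) (M : 'M[C]_p) r :
  (a *: M) ^+ r = a ^+ r *: M ^+ r.
Proof.
elim: r => [|r IH]; first by rewrite !expr0 scale1r.
rewrite !exprS IH -[LHS]/(_ *m _) -[M * _]/(_ *m _).
by rewrite -scalemxAl -scalemxAr scalerA.
Qed.

Section Exponential.
Variables (p : nat) (B : 'M[C]_p).

Let c (k l : 'I_p) (r : nat) : C := (r`!%:R)^-1 * (B ^+ r) k l.

Let partial (x : R) (N : nat) : 'M[C]_p :=
  \sum_(r < N) (r`!%:R : C)^-1 *: (x%:C%C *: B) ^+ r.

Let partialE x N k l : partial x N k l = \sum_(r < N) c k l r * (x ^+ r)%:C%C.
Proof.
rewrite /partial summxE; apply: eq_bigr => r _; rewrite exprZmx !mxE /c.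
by rewrite rmorphXn/= -mulrA; congr (_ * _); rewrite mulrC.
Qed.

Let c_bounded k l : exp_bounded (fun r => complex.Re (c k l r)) /\
  exp_bounded (fun r => complex.Im (c k l r)).
Proof.
(* The sum of the moduli of all entries dominates every row sum of moduli, so K^r bounds the entries
   of B^r by induction. *)
pose K : C := \sum_k \sum_l `|B k l|.
have K0 : 0 <= K by apply: sumr_ge0 => i _; apply: sumr_ge0.
have BK r : forall k l, `|(B ^+ r) k l| <= K ^+ r.
  elim: r => [|r IH] i j.
    by rewrite !expr0 mxE; case: eqP; rewrite ?normr1 ?normr0.
  rewrite !exprS mxE (le_trans (ler_norm_sum _ _ _))//.
  rewrite (le_trans (_ : _ <= \sum_s `|B i s| * K ^+ r))//.
    by apply: ler_sum => s _; rewrite normrM ler_wpM2l.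
  rewrite -mulr_suml ler_wpM2r ?exprn_ge0// /K [leRHS](bigD1 i)//= lerDl.
  by apply: sumr_ge0 => s _; apply: sumr_ge0.
have KE : K = (complex.Re K)%:C%C by rewrite RRe_real// ger0_real.
have cK r : `|c k l r| <= ((complex.Re K) ^+ r / r`!%:R)%:C%C.
  rewrite /c normrM normfV normr_nat mulrC rmorphM/= rmorphXn/= -KE.
  rewrite fmorphV/= rmorph_nat; apply: ler_wpM2r; last exact: BK.
  by rewrite invr_ge0.
have K0' : 0 <= complex.Re K by rewrite -ler0c -KE.
split; exists 1, (complex.Re K); split => // r; rewrite mul1r -lecR;
  apply: le_trans (cK r).
  exact: normc_ge_Re.
exact: normc_ge_Im.
Qed.

Let re (k l : 'I_p) r := complex.Re (c k l r).
Let im (k l : 'I_p) r := complex.Im (c k l r).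

Let RealM (z : C) (x : R) : complex.Re (z * x%:C%C) = complex.Re z * x.
Proof. by case: z => [a b]; rewrite /= mulr0 subr0. Qed.

Let ImagM (z : C) (x : R) : complex.Im (z * x%:C%C) = complex.Im z * x.
Proof. by case: z => [a b]; rewrite /= mulr0 add0r. Qed.

Let partial_Re x k l :
  (fun N => complex.Re (partial x N k l)) = pseries (re k l) x.
Proof.
apply/funext => N; rewrite partialE /pseries /series /= big_mkord raddf_sum.
by apply: eq_bigr => r _; exact: RealM.
Qed.

Let partial_Im x k l :
  (fun N => complex.Im (partial x N k l)) = pseries (im k l) x.
Proof.
apply/funext => N; rewrite partialE /pseries /series /= big_mkord raddf_sum.
by apply: eq_bigr => r _; exact: ImagM.
Qed.

Let partial_cvg x k l : (partial x N k l : C^o) @[N --> \oo] -->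
  ((limn (pseries (re k l) x)) +i* (limn (pseries (im k l) x)) : C^o)%C.
Proof.
have [br bi] := c_bounded k l.
apply/cvg_complexP; rewrite partial_Re partial_Im.
by split; exact: exp_bounded_cvg.
Qed.

Let expmxE x k l : expmx (x%:C%C *: B) k l =
  ((limn (pseries (re k l) x)) +i* (limn (pseries (im k l) x)))%C.
Proof.
rewrite mxE; exact: (cvg_lim (@norm_hausdorff _ C^o) (@partial_cvg x k l)).
Qed.

Let expmx_Re x k l :
  complex.Re (expmx (x%:C%C *: B) k l) = limn (pseries (re k l) x).
Proof. by rewrite expmxE. Qed.

Let expmx_Im x k l :
  complex.Im (expmx (x%:C%C *: B) k l) = limn (pseries (im k l) x).
Proof. by rewrite expmxE. Qed.

(** Each entry is differentiated termwise; the differentiated series has the entries of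
    [B *m partial x N] as partial sums, and these converge to the entries of B exp(xB). *)
Lemma is_mxderive_expmx (x : R) :
  is_mxderive setT (fun y => expmx (y%:C%C *: B)) x
    (B *m expmx (x%:C%C *: B)).
Proof.
have Ecvg : mxcvg \oo (partial x) (expmx (x%:C%C *: B)).
  by move=> k l; rewrite expmxE; exact: partial_cvg.
have BE : mxcvg \oo (fun N => B *m partial x N) (B *m expmx (x%:C%C *: B)).
  by apply: (mxcvgM _ Ecvg); exact: mxcvg_cst.
(* The index shift: (r+1) / (r+1)! = 1 / r! and B^(r+1) = B B^r, so the same [N] counts the terms on
   both sides. *)
have BP N k l : (B *m partial x N) k l =
    \sum_(r < N) (r.+1%:R * c k l r.+1) * (x ^+ r)%:C%C.
  rewrite mxE; under eq_bigr do rewrite partialE mulr_sumr.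
  rewrite exchange_big/=; apply: eq_bigr => r _.
  under eq_bigr do rewrite mulrA; rewrite -mulr_suml; congr (_ * _).
  rewrite /c exprS mxE factS natrM invfM mulrA mulrA mulfV ?pnatr_eq0// mul1r.
  by rewrite mulr_sumr; apply: eq_bigr => s _; rewrite mulrCA.
move=> k l; have [br bi] := c_bounded k l.
have natRe (n : nat) (z : C) : complex.Re (n%:R * z) = n%:R * complex.Re z.
  by rewrite !mulr_natl raddfMn.
have natIm (n : nat) (z : C) : complex.Im (n%:R * z) = n%:R * complex.Im z.
  by rewrite !mulr_natl raddfMn.
have /cvg_complexP[dr di] := BE k l.
have {}dr : limn (pseries (pseries_diffs (re k l)) x) =
    complex.Re ((B *m expmx (x%:C%C *: B)) k l).
  apply: cvg_lim => //; move: dr.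
  suff -> : (fun N => complex.Re ((B *m partial x N) k l)) =
    pseries (pseries_diffs (re k l)) x by [].
  apply/funext => N; rewrite BP /pseries /series /= big_mkord raddf_sum.
  by apply: eq_bigr => r _; rewrite [LHS]RealM natRe.
have {}di : limn (pseries (pseries_diffs (im k l)) x) =
    complex.Im ((B *m expmx (x%:C%C *: B)) k l).
  apply: cvg_lim => //; move: di.
  suff -> : (fun N => complex.Im ((B *m partial x N) k l)) =
    pseries (pseries_diffs (im k l)) x by [].
  apply/funext => N; rewrite BP /pseries /series /= big_mkord raddf_sum.
  by apply: eq_bigr => r _; rewrite [LHS]ImagM natIm.
apply/cvg_complexP; split.
  rewrite -dr; have := is_derive_cvg (is_derive_pseries x br).
  move=> /(cvg_within_filter setT).
  suff -> : (fun y => (y - x)^-1 *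
      (limn (pseries (re k l) y) - limn (pseries (re k l) x))) =
    (fun y => complex.Re (((y - x)^-1)%:C%C *
      (expmx (y%:C%C *: B) k l - expmx (x%:C%C *: B) k l))) by [].
  apply/funext => y; rewrite [_%:C%C * _]mulrC RealM [RHS]mulrC complexReB.
  congr (_ * (_ - _)); exact: (esym (expmx_Re _ k l)).
rewrite -di; have := is_derive_cvg (is_derive_pseries x bi).
move=> /(cvg_within_filter setT).
suff -> : (fun y => (y - x)^-1 *
    (limn (pseries (im k l) y) - limn (pseries (im k l) x))) =
  (fun y => complex.Im (((y - x)^-1)%:C%C *
    (expmx (y%:C%C *: B) k l - expmx (x%:C%C *: B) k l))) by [].
apply/funext => y; rewrite [_%:C%C * _]mulrC ImagM [RHS]mulrC complexImB.
congr (_ * (_ - _)); exact: (esym (expmx_Im _ k l)).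
Qed.

End Exponential.
End MatrixExponential.

(** * The canonical system *)

Section Adjoint.
Variable F : numClosedFieldType.

Lemma adjM (p q r : nat) (M : 'M[F]_(p, q)) (N : 'M[F]_(q, r)) :
  (M *m N) ^t* = N ^t* *m M ^t*.
Proof. by rewrite trmx_mul map_mxM. Qed.

Lemma adjB (p q : nat) (M N : 'M[F]_(p, q)) : (M - N) ^t* = M ^t* - N ^t*.
Proof. by rewrite linearB/= map_mxB. Qed.

Lemma adjN (p q : nat) (M : 'M[F]_(p, q)) : (- M) ^t* = - M ^t*.
Proof. by rewrite linearN/= map_mxN. Qed.

Lemma adjZ (p q : nat) (a : F) (M : 'M[F]_(p, q)) :
  (a *: M) ^t* = Num.conj a *: M ^t*.
Proof. by rewrite linearZ/= map_mxZ. Qed.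

Lemma adj_inv (p : nat) (M : 'M[F]_p) : (invmx M) ^t* = invmx (M ^t*).
Proof. by rewrite trmx_inv map_invmx. Qed.

Lemma adj_unit (p : nat) (M : 'M[F]_p) : (M ^t* \in unitmx) = (M \in unitmx).
Proof. by rewrite map_unitmx unitmx_tr. Qed.

End Adjoint.

(** * Pointwise matrix identities behind the conservation laws and the final derivative *)

Section SignatureAlgebra.
Variables (F : numClosedFieldType) (n m : nat).
Variables (A S : 'M[F]_n) (P : 'M[F]_(n, m)) (j H u : 'M[F]_m).
Hypotheses (jj : j *m j = 1%:M) (jH : j ^t* = j) (HH : H ^t* = H).

Lemma adj_dPi :
  (- 'i *: (A *m P *m j *m H)) ^t* = 'i *: (H *m j *m P ^t* *m A ^t*).
Proof. by rewrite adjZ rmorphN/= conjCi opprK !adjM jH HH !mulmxA. Qed.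

Lemma adj_dS : (P *m j *m H *m j *m P ^t*) ^t* = P *m j *m H *m j *m P ^t*.
Proof. by rewrite !adjM trmxCK jH HH !mulmxA. Qed.

Lemma dS_quad (v : 'cV[F]_n) :
  v ^t* *m (P *m j *m H *m j *m P ^t*) *m v =
  (j *m P ^t* *m v) ^t* *m H *m (j *m P ^t* *m v).
Proof. by rewrite !adjM trmxCK jH !mulmxA. Qed.

(** The summands are the derivatives of A S, - S A^* and - i Pi j Pi^*. The products (-i)(-i) = -1
    and (-i) i = 1 make the third cancel the first two. *)
Lemma operator_identity_derivative :
  A *m (P *m j *m H *m j *m P ^t*)
  + (- 1)%:M *m (P *m j *m H *m j *m P ^t* *m A ^t*)
  + (- 'i)%:M *m (- 'i *: (A *m P *m j *m H) *m j *m P ^t*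
    + P *m j *m ('i *: (H *m j *m P ^t* *m A ^t*))) = 0.
Proof.
rewrite !mul_scalar_mx -!scalemxAl -!scalemxAr scalerDr !scalerA mulrNN mulNr.
rewrite -expr2 sqrCi opprK scaleN1r scale1r !mulmxA.
by rewrite scaleN1r addrACA subrr addNr addr0.
Qed.

Hypothesis SH : S ^t* = S.

(** The value of [q0tilde] at one point. *)
Let q := j *m P ^t* *m invmx S *m P *m j *m H
  - j *m H *m j *m P ^t* *m invmx S *m P.

Let adj_q : q ^t* = H *m j *m P ^t* *m invmx S *m P *m j
  - P ^t* *m invmx S *m P *m j *m H *m j.
Proof. by rewrite adjB !adjM !trmxCK adj_inv SH HH jH !mulmxA. Qed.

(* With the Hermitian matrix [X = P^* S^-1 P] one has [j q = X j H - H j X],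
   which is skew-Hermitian. *)
Lemma q_j_skew : q ^t* *m j + j *m q = 0.
Proof.
rewrite adj_q /q mulmxBl mulmxBr !mulmxA jj !mul1mx.
rewrite -![_ *m j *m j]mulmxA jj !mulmx1.
by rewrite addrA subrK subrr.
Qed.

(** This is the derivative of u^* j u along u' = - q u; it equals - u^* (q^* j + j q) u. *)
Lemma u_j_form_derivative :
  (- (q *m u)) ^t* *m j *m u + u ^t* *m j *m (- (q *m u)) = 0.
Proof.
transitivity (- (u ^t* *m (q ^t* *m j + j *m q) *m u)).
  by rewrite adjN adjM mulmxDr mulmxDl opprD !mulNmx mulmxN !mulmxA.
by rewrite q_j_skew mulmx0 mul0mx oppr0.
Qed.

Hypotheses (Su : S \in unitmx)
  (opid : A *m S - S *m A ^t* = 'i *: (P *m j *m P ^t*)).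

(** The operator identity times - i, with S^-1 on both sides. It moves A to the right of S^-1, next
    to the exponential. *)
Lemma inv_operator_identity :
  'i *: (invmx S *m A) = 'i *: (A ^t* *m invmx S)
    - invmx S *m P *m j *m P ^t* *m invmx S.
Proof.
have := congr1 (fun M => - 'i *: (invmx S *m M *m invmx S)) opid.
rewrite -scalemxAr -scalemxAl scalerA mulNr -expr2 sqrCi opprK scale1r.
rewrite mulmxBr mulmxBl !mulmxA mulVmx// mul1mx mulmxK// => <-.
by rewrite scaleNr opprK scalerBr addrCA subrr addr0.
Qed.

(** The left side is the product rule for j u^* P^* S^-1 E. The second term of [q ^t*] cancels the
    derivative of S^-1; the first joins the A^* term, and [inv_operator_identity] turns the two into
    i H j P^* S^-1 A. *)
Lemma HY_derivative (E : 'M[F]_n) :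
  j *m ((- (q *m u)) ^t* *m (P ^t* *m invmx S)
    + u ^t* *m ('i *: (H *m j *m P ^t* *m A ^t*) *m invmx S
        + P ^t* *m - (invmx S *m (P *m j *m H *m j *m P ^t*) *m invmx S))) *m E
  = j *m (u ^t* *m H *m j *m P ^t* *m invmx S *m ('i *: A *m E)).
Proof.
rewrite [RHS]mulmxA [RHS]mulmxA -[j *m _ *m ('i *: A)]mulmxA.
congr (_ *m _ *m _).
transitivity (u ^t* *m (H *m j *m P ^t* *m ('i *: (invmx S *m A)))).
  rewrite inv_operator_identity adjN adjM adj_q.
  rewrite mulNmx -[u ^t* *m _ *m _]mulmxA -mulmxN -mulmxDr; congr (_ *m _).
  rewrite mulmxBl mulmxBr mulmxN opprB !mulmxA -scalemxAl -scalemxAr !mulmxA.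
  by rewrite addrC addrA subrK.
by rewrite -!scalemxAr !mulmxA.
Qed.

(** Cancelling removes H and all inverses except S^-1, so that only u, Pi and S, whose derivatives
    are given, remain to be differentiated in x. *)
Lemma HY_simpl (E : 'M[F]_n) :
  u \in unitmx -> H \in unitmx -> invmx u = j *m u ^t* *m j ->
  invmx u *m invmx H *m invmx (u ^t*)
    *m (u ^t* *m H *m j *m P ^t* *m invmx S *m E)
  = j *m (u ^t* *m (P ^t* *m invmx S)) *m E.
Proof.
move=> uu Hu uV; rewrite !mulmxA mulmxKV ?adj_unit// mulmxKV//.
by rewrite uV -[_ *m j *m j]mulmxA jj mulmx1.
Qed.

End SignatureAlgebra.

(** * Positive definite matrices: invertibility, inverse, congruence *)

Section PositiveDefinite.
Variable R : realType.
Local Notation C := R[i].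

(** A null vector would make the quadratic form vanish. Since [kermx] collects row vectors, null
    columns of M are transposed rows of [kermx M^T]. *)
Lemma posdefmx_unit (p : nat) (M : 'M[C]_p) : posdefmx M -> M \in unitmx.
Proof.
move=> [_ M0]; rewrite -unitmx_tr -row_free_unit -kermx_eq0.
apply/eqP/row_matrixP => i; rewrite row0; apply/eqP/negP => /negP k0.
have := M0 (row i (kermx M^T))^T; rewrite -mulmxA.
have -> : M *m (row i (kermx M^T))^T = 0.
  by apply: trmx_inj; rewrite trmx_mul trmxK -row_mul mulmx_ker row0 trmx0.
rewrite mulmx0 mxE ltxx => /(_ _)/notF; apply.
by rewrite -[X in _ != X]trmx0 (inj_eq trmx_inj).
Qed.

(** For w = M^-1 v the form v^* M^-1 v equals w^* M w, as M is Hermitian. *)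
Lemma posdefmx_invmx (p : nat) (M : 'M[C]_p) : posdefmx M -> posdefmx (invmx M).
Proof.
move=> Mpos; have Mu := posdefmx_unit Mpos; have [MH M0] := Mpos.
split=> [|v v0]; first by rewrite adj_inv MH.
have w0 : invmx M *m v != 0.
  by apply: contra_neq v0 => w0; rewrite -(mulKVmx Mu v) w0 mulmx0.
by have := M0 _ w0; rewrite adjM adj_inv MH -!mulmxA mulKVmx.
Qed.

Lemma posdefmx_congr (p : nat) (M N : 'M[C]_p) :
  N \in unitmx -> posdefmx M -> posdefmx (N *m M *m N ^t*).
Proof.
move=> Nu [MH M0]; split=> [|v v0]; first by rewrite !adjM trmxCK MH mulmxA.
have w0 : N ^t* *m v != 0.
  have Nu' : N ^t* \in unitmx by rewrite adj_unit.
  by apply: contra_neq v0 => w0; rewrite -(mulKmx Nu' v) w0 mulmx0.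
by have := M0 _ w0; rewrite adjM trmxCK !mulmxA.
Qed.

End PositiveDefinite.

(** * The signature matrix as a Hermitian involution *)

Section SignatureMatrix.
Variables (R : realType) (m1 m2 : nat).
Local Notation j := (@jmx R m1 m2).

Lemma jmx_sqr : j *m j = 1%:M.
Proof.
rewrite /jmx mulmx_block !(mul0mx, mulmx0, addr0, add0r) mulmx1.
by rewrite mulmxN mulNmx mulmx1 opprK -scalar_mx_block.
Qed.

Lemma jmx_adj : j ^t* = j.
Proof.
rewrite /jmx tr_block_mx map_block_mx !trmx0 !map_mx0 linearN/= map_mxN.
by rewrite !trmx1 !map_mx1.
Qed.

End SignatureMatrix.

(** * Conservation laws on the half-line and the derivative of the product in x *)

Section CanonicalSystem.
Variables (R : realType) (n m1 m2 : nat).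
Local Notation C := R[i].
Local Notation m := (m1 + m2)%N.
Local Notation D := (`[0 : R, +oo[%classic).
Local Notation j := (@jmx R m1 m2).
Variables (H : R -> 'M[C]_m) (A : 'M[C]_n).
Variables (Pi : R -> 'M[C]_(n, m)) (S : R -> 'M[C]_n) (u : R -> 'M[C]_m).
Hypothesis hH : forall x : R, 0 <= x -> posdefmx (H x).
Hypothesis hS0 : posdefmx (S 0).
Hypothesis hid : A *m S 0 - S 0 *m A ^t* = 'i *: (Pi 0 *m j *m (Pi 0) ^t*).
Hypothesis hPi : forall x : R, 0 <= x ->
  is_mxderive D Pi x (- 'i *: (A *m Pi x *m j *m H x)).
Hypothesis hS : forall x : R, 0 <= x ->
  is_mxderive D S x (Pi x *m j *m H x *m j *m (Pi x) ^t*).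
Hypothesis hu : forall x : R, 0 <= x ->
  is_mxderive D u x (- (q0tilde H Pi S x *m u x)).
Hypothesis hu0 : u 0 = 1%:M.

Let HH (x : R) : 0 <= x -> (H x) ^t* = H x.
Proof. by move=> /hH[]. Qed.

Let hPi_adj (x : R) : 0 <= x ->
  is_mxderive D (fun y => (Pi y) ^t*) x
    ('i *: (H x *m j *m (Pi x) ^t* *m A ^t*)).
Proof.
move=> x0; apply: is_mxderive_eq (is_mxderive_adj (hPi x0)) _.
exact: (adj_dPi _ _ (jmx_adj R m1 m2) (HH x0)).
Qed.

(** S' is Hermitian, so S^* - S is constant, and it vanishes at 0. *)
Lemma S_herm (x : R) : 0 <= x -> (S x) ^t* = S x.
Proof.
move=> x0; apply/eqP; rewrite -subr_eq0.
have hD (y : R) : 0 <= y ->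
    is_mxderive D (fun z => (S z) ^t* + (- 1)%:M *m S z) y 0.
  move=> y0; apply: is_mxderive_eq (is_mxderiveD (is_mxderive_adj (hS y0))
    (is_mxderiveMl (M := (- 1)%:M) (hS y0))) _.
  rewrite mul_scalar_mx scaleN1r; apply/eqP; rewrite subr_eq0; apply/eqP.
  exact: (adj_dS _ (jmx_adj R m1 m2) (HH y0)).
have := is_mxderive0_cst hD x0; rewrite /= !mul_scalar_mx !scaleN1r => ->.
by rewrite hS0.1 subrr.
Qed.

Lemma S_posdef (x : R) : 0 <= x -> posdefmx (S x).
Proof.
move=> x0; split=> [|v v0]; first exact: S_herm.
have hD (y : R) : 0 <= y -> is_mxderive D (fun z => v ^t* *m S z *m v) y
    (v ^t* *m (Pi y *m j *m H y *m j *m (Pi y) ^t*) *m v).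
  by move=> y0; apply: is_mxderiveMr; apply: is_mxderiveMl; exact: hS.
have le0 (y : R) : 0 <= y -> 0 <= complex.Re
    ((v ^t* *m (Pi y *m j *m H y *m j *m (Pi y) ^t*) *m v) ord0 ord0).
  move=> y0; pose w := j *m (Pi y) ^t* *m v.
  rewrite (dS_quad _ _ (jmx_adj R m1 m2)) -/w.
  have [->|w0] := eqVneq w 0; first by rewrite mulmx0 mxE.
  have Hw := (hH y0).2 w w0.
  by rewrite -lecR (RRe_real (gtr0_real Hw)) ltW.
have re0 : 0 < complex.Re ((v ^t* *m S 0 *m v) ord0 ord0).
  have S0v := hS0.2 v v0.
  by rewrite -ltcR (RRe_real (gtr0_real S0v)).
have le := is_mxderive_Re_le hD le0 x0.
(* Monotonicity controls only the real part; the form is real because [S x] is Hermitian. *)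
have : (v ^t* *m S x *m v) ord0 ord0 \is Num.real.
  apply/CrealP; have : (v ^t* *m S x *m v) ^t* = v ^t* *m S x *m v.
    by rewrite !adjM trmxCK S_herm// mulmxA.
  by move=> /matrixP/(_ ord0 ord0); rewrite !mxE.
move=> /RRe_real <-; rewrite -[X in X < _]/(0%:C%C) ltcR.
exact: lt_le_trans re0 le.
Qed.

Lemma S_unit (x : R) : 0 <= x -> S x \in unitmx.
Proof. by move=> /S_posdef/posdefmx_unit. Qed.

Lemma operator_identity (x : R) : 0 <= x ->
  A *m S x - S x *m A ^t* = 'i *: (Pi x *m j *m (Pi x) ^t*).
Proof.
move=> x0.
(* Differences are written with scalar matrix factors, so that the sum and product rules suffice. *)
pose f y := (A *m S y + (- 1)%:M *m (S y *m A ^t*))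
  + (- 'i)%:M *m (Pi y *m j *m (Pi y) ^t*).
have fd (y : R) : 0 <= y -> is_mxderive D f y 0.
  move=> y0; apply: is_mxderive_eq (is_mxderiveD
    (is_mxderiveD (is_mxderiveMl (M := A) (hS y0))
      (is_mxderiveMl (M := (- 1)%:M) (is_mxderiveMr (M := A ^t*) (hS y0))))
    (is_mxderiveMl (M := (- 'i)%:M)
      (is_mxderiveM (is_mxderiveMr (M := j) (hPi y0)) (hPi_adj y0)))) _.
  exact: operator_identity_derivative.
have := is_mxderive0_cst fd x0; rewrite /f !mul_scalar_mx !scaleN1r hid.
by rewrite !scaleNr subrr => /eqP; rewrite subr_eq0 => /eqP.
Qed.

Lemma u_jmx_unitary (x : R) : 0 <= x -> (u x) ^t* *m j *m u x = j.
Proof.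
move=> x0.
have ud (y : R) : 0 <= y -> is_mxderive D (fun z => (u z) ^t* *m j *m u z) y 0.
  move=> y0; apply: is_mxderive_eq (is_mxderiveM
    (is_mxderiveMr (M := j) (is_mxderive_adj (hu y0))) (hu y0)) _.
  exact: (u_j_form_derivative _ _ (jmx_sqr R m1 m2) (jmx_adj R m1 m2)
    (HH y0) (S_herm y0)).
have := is_mxderive0_cst ud x0; rewrite /= hu0 => ->.
by rewrite mulmx1 trmx1 map_mx1 mul1mx.
Qed.

(** Multiply u^* j u = j by j on the left. For a square matrix a left inverse already yields
    invertibility. *)
Lemma u_left_inv (x : R) : 0 <= x -> (j *m (u x) ^t* *m j) *m u x = 1%:M.
Proof. by move=> x0; rewrite -!mulmxA (mulmxA _ j) u_jmx_unitary// jmx_sqr. Qed.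

Lemma u_unit (x : R) : 0 <= x -> u x \in unitmx.
Proof. by move=> /u_left_inv/mulmx1_unit[]. Qed.

Lemma u_inv (x : R) : 0 <= x -> invmx (u x) = j *m (u x) ^t* *m j.
Proof.
move=> x0; rewrite -[RHS]mulmx1 -(mulmxV (u_unit x0)) mulmxA.
by rewrite u_left_inv// mul1mx.
Qed.

(** [calH] is the congruence N H^-1 N^* with N = u^-1. *)
Lemma calH_posdef (x : R) : 0 <= x -> posdefmx (calH H u x).
Proof.
move=> x0; rewrite /calH -adj_inv; apply: posdefmx_congr.
  by rewrite unitmx_inv u_unit.
exact/posdefmx_invmx/hH.
Qed.

Lemma calH_Ymx (x t : R) : 0 <= x ->
  calH H u x *m Ymx A H Pi S u x t =
  j *m ((u x) ^t* *m ((Pi x) ^t* *m invmx (S x)))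
    *m expmx (('i * t%:C%C) *: A).
Proof.
move=> x0.
exact: (HY_simpl _ _ (jmx_sqr R m1 m2) _ (u_unit x0) (posdefmx_unit (hH x0))
  (u_inv x0)).
Qed.

Lemma is_mxderive_calH_Ymx (x t : R) : 0 <= x ->
  is_mxderive D (fun y => calH H u y *m Ymx A H Pi S u y t) x
    (j *m ((u x) ^t* *m H x *m j *m (Pi x) ^t* *m invmx (S x)
      *m (('i *: A) *m expmx (('i * t%:C%C) *: A)))).
Proof.
move=> x0.
have DP (y : R) : D y -> 0 <= y by rewrite /= in_itv/= andbT.
have Dx : D x by rewrite /= in_itv/= andbT.
have DS (y : R) : D y -> S y \in unitmx by move=> /DP/S_unit.
(* The simplified product is known to agree with the original one only on the half-line, which is
   enough for a derivative within [D]. *)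
apply: (@eq_is_mxderive _ _ _ _ _ (fun y =>
  j *m ((u y) ^t* *m ((Pi y) ^t* *m invmx (S y)))
    *m expmx (('i * t%:C%C) *: A))) => //.
  by move=> y /DP y0; rewrite calH_Ymx.
apply: is_mxderive_eq (is_mxderiveMr (is_mxderiveMl (is_mxderiveM
  (is_mxderive_adj (hu x0))
  (is_mxderiveM (hPi_adj x0) (is_mxderive_invmx Dx DS (hS x0)))))) _.
exact: (HY_derivative _ (jmx_adj R m1 m2) (HH x0) (S_herm x0) (S_unit x0)
  (operator_identity x0) _).
Qed.

End CanonicalSystem.

Theorem theorem2p1 (R : realType) (n m1 m2 : nat) (hm : (0 < m1 + m2)%N)
    (H : R -> 'M[R[i]]_(m1 + m2))
    (hH : forall x : R, 0 <= x -> posdefmx (H x))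
    (A : 'M[R[i]]_n)
    (Pi : R -> 'M[R[i]]_(n, m1 + m2))
    (S : R -> 'M[R[i]]_n)
    (u : R -> 'M[R[i]]_(m1 + m2))
    (hS0 : posdefmx (S 0))
    (hid : A *m S 0 - S 0 *m A ^t*
           = 'i *: (Pi 0 *m jmx m1 m2 *m (Pi 0) ^t*))
    (hPi : forall x : R, 0 <= x ->
       is_mxderive `[0, +oo[ Pi x
         (- 'i *: (A *m Pi x *m jmx m1 m2 *m H x)))
    (hS : forall x : R, 0 <= x ->
       is_mxderive `[0, +oo[ S x
         (Pi x *m jmx m1 m2 *m H x *m jmx m1 m2 *m (Pi x) ^t*))
    (hu : forall x : R, 0 <= x ->
       is_mxderive `[0, +oo[ u x (- (q0tilde H Pi S x *m u x)))
    (hu0 : u 0 = 1%:M) :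
  (forall x t : R, 0 <= x ->
     exists dHY : 'M[R[i]]_(m1 + m2, n),
       is_mxderive `[0, +oo[
         (fun x' : R => calH H u x' *m Ymx A H Pi S u x' t) x dHY /\
       is_mxderive setT
         (fun t' : R => Ymx A H Pi S u x t') t (jmx m1 m2 *m dHY)) /\
  (forall x : R, 0 <= x -> posdefmx (calH H u x)).
Proof.
split=> [x t x0|x x0]; last exact: (calH_posdef hH hS0 hS hu hu0 x0).
(* The witness is j times the t-derivative of Y; since j^2 = 1, the second claim reduces to
   differentiating the exponential. *)
exists (jmx m1 m2 *m ((u x) ^t* *m H x *m jmx m1 m2 *m (Pi x) ^t*
  *m invmx (S x) *m ('i *: A *m expmx (('i * t%:C%C) *: A)))).
split; first exact: (is_mxderive_calH_Ymx hH hS0 hid hPi hS hu hu0 x0).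
rewrite mulmxA jmx_sqr mul1mx.
(* The exponent is read as t times B = iA, to which [is_mxderive_expmx] applies. *)
have iA (y : R) : ('i * y%:C%C) *: A = y%:C%C *: ('i *: A).
  by rewrite scalerA mulrC.
have Ed : is_mxderive setT (fun y => expmx (('i * y%:C%C) *: A)) t
    ('i *: A *m expmx (('i * t%:C%C) *: A)).
  under eq_fun do rewrite iA.
  by rewrite iA; exact: is_mxderive_expmx.
exact: (is_mxderiveMl Ed).
Qed.
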